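(* Let $b\ge 2$ be an integer and $\mathcal B_b=\{0,1,\dots,b-1\}\subset\mathcal N$. Almost every element of $\mathcal B_b[[x]]$ (with respect to the probability measure $m$ on $\mathcal B_b[[x]]$) is asymptotically irreducible; that is, the set of $f\in\mathcal B_b[[x]]$ that are not asymptotically irreducible has $m$-measure $0$.
   Context: Here $\mathbb N$ contains $0$. The max-min semiring is $\mathcal N=(\mathbb N\cup\{\infty\},\oplus,\otimes)$ with $a\oplus b=\max(a,b)$ and $a\otimes b=\min(a,b)$; its zero element is $0$. $\mathcal B_b=\{0,1,\dots,b-1\}$ is closed under both operations. Formal power series are added coefficientwise with $\oplus$ and multiplied by convolution: if $f=\bigoplus_k\alpha_kx^k$ and $g=\bigoplus_k\beta_kx^k$, the coefficient of $x^n$ in $fg=f\otimes g$ is $\max_{0\le k\le n}\min(\alpha_k,\beta_{n-k})$. A monomial is an element with at most one nonzero coefficient, i.e. of the form $cx^k$. For $f,g\in\mathcal N[[x]]$ write $f\sim g$ if $f$ and $g$ differ in only finitely many coefficients. An element $f\in\mathcal N[[x]]$ is asymptotically irreducible if $f\sim gh$ (with $g,h\in\mathcal N[[x]]$) implies that $g$ or $h$ is a monomial. Measure: define $\rho_b:\mathcal B_b[[x]]\to[0,b]$ by $\rho_b\left(\bigoplus_{k\ge0}a_kx^k\right)=\sum_{k=0}^\infty a_kb^{-k}$ (an ordinary real sum). For $A\subset\mathcal B_b[[x]]$ such that $\rho_b(A)$ is Lebesgue measurable, $m(A)=b^{-1}\mathcal L(\rho_b(A))$, where $\mathcal L$ is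 Lebesgue measure on $\mathbb R$. *)

(* Defs.v *)
From mathcomp Require Import all_boot all_order all_algebra.
From mathcomp Require Import all_classical all_reals all_analysis.
From mathcomp Require Import measurable_realfun.

Set Implicit Arguments.
Unset Strict Implicit.
Unset Printing Implicit Defensive.

Import Order.TTheory GRing.Theory Num.Theory.
Import numFieldNormedType.Exports.

Local Open Scope classical_set_scope.
Local Open Scope ring_scope.

Inductive maxmin : Type := Fin of nat | Inf.

Definition mm_zero : maxmin := Fin 0.

Definition mm_add (a b : maxmin) : maxmin :=
  match a, b with
  | Fin m, Fin n => Fin (maxn m n)
  | _, _ => Inf
  end.

Definition mm_mul (a b : maxmin) : maxmin :=
  match a, b with
  | Fin m, Fin n => Fin (minn m n)
  | Fin m, Inf => Fin m
  | Inf, _ => b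
  end.

(* [f k] is the coefficient of x^k. *)
Definition mm_series : Type := nat -> maxmin.

Definition mm_series_mul (f g : mm_series) : mm_series :=
  fun n => \big[mm_add/mm_zero]_(k < n.+1) mm_mul (f k) (g (n - k)%N).

Definition is_monomial (f : mm_series) : Prop :=
  exists (c : maxmin) (k : nat),
    forall n : nat, f n = if n == k then c else mm_zero.

Definition asymp_equiv (f g : mm_series) : Prop :=
  finite_set [set k | f k <> g k].

Definition asymp_irreducible (f : mm_series) : Prop :=
  forall g h : mm_series,
    asymp_equiv f (mm_series_mul g h) -> is_monomial g \/ is_monomial h.

Definition digit_series (b : nat) : Type := nat -> 'I_b.

Definition series_of_digits (b : nat) (a : digit_series b) : mm_series :=
  fun k => Fin (a k).

Definition rho (R : realType) (b : nat) (a : digit_series b) : R :=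
  limn (series (fun k => (a k)%:R / b%:R ^+ k : R)).

(* Lebesgue measurable: Borel up to a null set. *)
Definition lebesgue_measurable (R : realType) (X : set R) : Prop :=
  (completed_algebra_gen (@lebesgue_measure R)).-sigma.-measurable X.

(* As in the library, [completed_lebesgue_measure] is a total function (the
   outer measure), so [m_measure A] is meaningful only when the image of [A]
   under [rho] is Lebesgue measurable. *)
Definition m_measurable (R : realType) (b : nat) (A : set (digit_series b))
  : Prop := lebesgue_measurable (@rho R b @` A).

Definition m_measure (R : realType) (b : nat) (A : set (digit_series b))
  : \bar R :=
  ((b%:R^-1)%:E * completed_lebesgue_measure (@rho R b @` A))%E.

(* Main.v *)
(* Only the support F of the digit sequence matters: if f ~ g h then F agrees,
   up to finitely many elements, with the sumset G + H of the supports of g and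
   h, both of which have at least two elements. If G is bounded, then from some
   point on F has no isolated element, whereas a typical F has isolated elements
   with arbitrarily long gaps on both sides infinitely often. If G and H are
   both unbounded, then F contains almost all of H + {g_1, ..., g_k} for any k
   elements g_i of G, and this forces H to have density less than 1/L for a
   typical F once k is large; likewise for G. But F up to n is determined by
   G and H up to n, and there are too few pairs of sets of density less than 1/L
   to produce a positive proportion of all words of length n. *)
Require Import Defs.
From mathcomp Require Import all_boot all_order all_algebra.
From mathcomp Require Import all_classical all_reals all_analysis.
From mathcomp Require Import zify ring lra.

Set Implicit Arguments.
Unset Strict Implicit.
Unset Printing Implicit Defensive.

Import Order.TTheory GRing.Theory Num.Theory.
Import numFieldNormedType.Exports.

Local Open Scope classical_set_scope.
Local Open Scope ring_scope.

(** * Null sets of digit sequences *)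

Section DigitSeries.
Variables (R : realType) (b : nat).
Hypothesis hb : (2 <= b)%N.

Let b0 : 0 < b%:R :> R. Proof. by rewrite ltr0n; lia. Qed.

(** The majorant telescopes: $(b-1)/b^k = b/b^k - b/b^{k+1}$. *)
Lemma telescope_digit_sum (u : nat -> R) n N : (n <= N)%N ->
  (forall k, (n <= k)%N -> `|u k| <= (b%:R - 1) / b%:R ^+ k) ->
  `|\sum_(n <= k < N) u k| <= b%:R / b%:R ^+ n - b%:R / b%:R ^+ N.
Proof.
move=> nN hu; rewrite (le_trans (ler_norm_sum _ _ _))//.
rewrite -opprB -(@telescope_sumr _ n N (fun k => b%:R / b%:R ^+ k))// -sumrN.
rewrite big_nat_cond [leRHS]big_nat_cond ler_sum// => k /andP[/andP[nk _] _].
rewrite (le_trans (hu _ nk))// le_eqVlt; apply/orP; left; apply/eqP.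
rewrite exprS; field.
by rewrite ?expf_neq0 ?(gt_eqF b0).
Qed.

Lemma norm_digitB (d e : 'I_b) : `|d%:R - e%:R| <= b%:R - 1 :> R.
Proof.
have dig (c : 'I_b) : (c%:R <= b%:R - 1 :> R).
  by rewrite lerBrDr -(natrD _ c 1) ler_nat addn1.
have := dig d; have := dig e.
have := ler0n R d; have := ler0n R e => *.
by rewrite ler_norml; apply/andP; split; lra.
Qed.

Lemma cvg_digit_series (a : digit_series b) :
  cvgn (series (fun k => (a k)%:R / b%:R ^+ k : R)).
Proof.
apply: nondecreasing_is_cvgn.
  apply: nondecreasing_series => k _ _.
  by rewrite divr_ge0// exprn_ge0// ltW.
exists b%:R => _ [n _ <-].
rewrite /series/=.
have := @telescope_digit_sum (fun k => (a k)%:R / b%:R ^+ k) 0 n (leq0n _) _.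
rewrite expr0 divr1 => H.
apply: le_trans (ler_norm _) _; apply: le_trans (H _) _; last first.
  by rewrite gerBl divr_ge0// ?exprn_ge0// ltW.
move=> k _; rewrite normrM [X in _ * X]ger0_norm ?invr_ge0 ?exprn_ge0 ?(ltW b0)//.
rewrite ler_pM2r ?invr_gt0 ?exprn_gt0//.
by have := norm_digitB (a k) (Ordinal (ltnW hb)); rewrite subr0.
Qed.

(** The first [n] terms cancel in the difference, and [telescope_digit_sum] bounds the remaining
    tail. *)
Lemma rho_close (a c : digit_series b) n :
  (forall k, (k < n)%N -> a k = c k) ->
  `|rho R a - rho R c| <= b%:R / b%:R ^+ n.
Proof.
move=> ac.
have cvg_diff : series (fun k => (a k)%:R / b%:R ^+ k - (c k)%:R / b%:R ^+ k : R)
    @ \oo --> rho R a - rho R c.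
  rewrite [X in X @ _](_ : _ = series (fun k => (a k)%:R / b%:R ^+ k)
    - series (fun k => (c k)%:R / b%:R ^+ k)).
    by apply: cvgB; exact: cvg_digit_series.
  by apply/funext => N; rewrite /series/= sumrB.
apply: (@le_trans _ _ (limn (fun N => `|series (fun k => (a k)%:R / b%:R ^+ k
   - (c k)%:R / b%:R ^+ k : R) N|))).
  by rewrite (cvg_lim _ (cvg_norm cvg_diff)).
apply: limr_le; first by apply: (cvgP _ (cvg_norm cvg_diff)).
near=> N.
have nN : (n <= N)%N by near: N; exists n.
rewrite /series/= (@big_cat_nat _ _ _ n)//= big_nat big1 ?add0r; last first.
  by move=> k /andP[_ kn]; rewrite ac// subrr.
apply: le_trans (telescope_digit_sum nN _) _; last first.
  by rewrite gerBl divr_ge0// ?exprn_ge0// ltW.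
move=> k _; rewrite -mulrBl normrM [X in _ * X]ger0_norm ?invr_ge0 ?exprn_ge0 ?(ltW b0)//.
by rewrite ler_pM2r ?invr_gt0 ?exprn_gt0// norm_digitB.
Unshelve. all: by end_near. Qed.

(** Negligibility passes to subsets and countable unions, so measurability is settled only once, in
    [null_digits_measure0]. *)
Definition null_digits (A : set (digit_series b)) : Prop :=
  (@lebesgue_measure R).-negligible (@rho R b @` A).

Lemma null_digitsS A B : A `<=` B -> null_digits B -> null_digits A.
Proof. by move=> AB; apply: negligibleS; apply: image_subset. Qed.

Lemma null_digitsU A B :
  null_digits A -> null_digits B -> null_digits (A `|` B).
Proof. by move=> nA nB; rewrite /null_digits image_setU; exact: negligibleU. Qed.

Lemma null_digits_bigcup (A : (set (digit_series b))^nat) :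
  (forall i, null_digits (A i)) -> null_digits (\bigcup_i A i).
Proof.
move=> nA; rewrite /null_digits image_bigcup; exact: negligible_bigcup.
Qed.

Lemma null_digits_measure0 (A : set (digit_series b)) :
  null_digits A -> m_measurable R A /\ m_measure R A = 0%E.
Proof.
move=> nA; split.
  apply: sub_sigma_algebra; exists set0 => //; exists (@rho R b @` A) => //.
  by rewrite set0U.
rewrite /m_measure.
have /negligible_outer_measure h := nA.
suff -> : completed_lebesgue_measure (@rho R b @` A) = 0%E by rewrite mule0.
exact: h.
Qed.

Local Open Scope ereal_scope.

(** All sequences with the same code share their first [n] digits, so by [rho_close] their images
    lie within $b/b^n$ of any one of them. One interval for each code in [T] covers the image of
    [A]. *)
Lemma cylinder_cover (W : finType) (enc : digit_series b -> W) n (T : {set W})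
    (A : set (digit_series b)) :
  (forall a c, enc a = enc c -> forall k, (k < n)%N -> a k = c k) ->
  (forall a, A a -> enc a \in T) ->
  completed_lebesgue_measure (@rho R b @` A) <=
    (#|T|%:R * (2 * b%:R / b%:R ^+ n))%:E.
Proof.
move=> enc_inj AT.
pose d : R := (b%:R / b%:R ^+ n)%R.
have d0 : (0 < d)%R by rewrite divr_gt0// exprn_gt0.
(* The centre is the image of some sequence with code [w]; the default 0 occurs only for codes that
   no sequence has. *)
pose c w := xget 0%R (@rho R b @` [set a | enc a = w]).
pose I w : set R := [set` `[(c w - d)%R, (c w + d)%R]].
have AI : @rho R b @` A `<=` \big[setU/set0]_(w in T) I w.
  move=> _ [a Aa <-]; rewrite -bigcup_pred; exists (enc a); first exact: AT.
  rewrite /I /c; case: xgetP => [y _ [a' aa' <-]|/(_ (rho R a)) []]; last by exists a.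
  by rewrite /= in_itv/= -ler_distl; exact: rho_close (enc_inj _ _ (esym aa')).
(* Both Lebesgue measure and its completion unfold to this outer measure, which is subadditive on
   all sets. *)
pose mu := (wlength (@idfun R))^*%mu.
have muI w : mu (I w) = (2 * b%:R / b%:R ^+ n)%:E.
  transitivity (lebesgue_measure (I w)) => //; rewrite lebesgue_measure_itv/=.
  rewrite lte_fin ifT; last lra.
  by rewrite -EFinB /d; congr (_%:E); lra.
apply: (@le_trans _ _ (mu (\big[setU/set0]_(w in T) I w))).
  exact: le_outer_measure.
apply: (@le_trans _ _ (\sum_(w in T) mu (I w))).
  elim/big_ind2: _ => [|X x Y y Xx Yy|//]; first by rewrite /mu outer_measure0.
  by rewrite (le_trans (outer_measureU2 _ _ _))// leeD.
rewrite (eq_bigr (fun=> (2 * b%:R / b%:R ^+ n)%:E)); last by move=> w _; exact: muI.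
by rewrite sumEFin lee_fin sumr_const -[leLHS]mulr_natl.
Qed.

(** This reduces nullity to counting words of length [n]. The code stays abstract so that digits may
    be grouped into blocks. *)
Lemma null_digits_small (A : set (digit_series b)) :
  (forall e : R, (0 < e)%R -> exists n (W : finType) (enc : digit_series b -> W)
     (T : {set W}),
     [/\ forall a c, enc a = enc c -> forall k, (k < n)%N -> a k = c k,
         forall a, A a -> enc a \in T & (#|T|%:R / b%:R ^+ n < e)%R]) ->
  null_digits A.
Proof.
move=> hA; apply/negligible_outer_measure; apply/eqP.
rewrite eq_le outer_measure_ge0 andbT; apply/lee_addgt0Pr => e e0.
have [|n [W [enc [T [enc_inj AT Te]]]]] := hA (e / (2 * b%:R))%R.
  by rewrite divr_gt0// mulr_gt0.
apply: (le_trans (cylinder_cover enc_inj AT)).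
rewrite add0e lee_fin.
rewrite ltr_pdivlMr ?mulr_gt0// in Te.
by apply: le_trans (ltW Te); rewrite le_eqVlt; apply/orP; left; apply/eqP; ring.
Qed.
End DigitSeries.

(** * Geometric decay and counting of words and sets *)

Lemma exists_expr_lt (R : realType) (q e : R) : 0 <= q < 1 -> 0 < e ->
  exists k, forall n, (k <= n)%N -> q ^+ n < e.
Proof.
move=> /andP[q0 q1] e0.
have /cvgrPdist_lt/(_ e e0)[k _ hk] : q ^+ n @[n --> \oo] --> (0 : R).
  by apply: cvg_expr; rewrite ger0_norm.
exists k => n kn; have := hk n kn.
by rewrite sub0r normrN ger0_norm// exprn_ge0.
Qed.

Section Counting.
Variable R : realType.

(** The conditions concern separate coordinates, so the count is a product: each constrained
    coordinate contributes at most [c], each free one [#|T|]. *)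
Lemma card_words_le (I T : finType) (A : {set I}) (P : I -> pred T) (c : nat) :
  (0 < #|T|)%N -> (forall i, i \in A -> (#|P i| <= c)%N) ->
  #|[set w : {ffun I -> T} | [forall i in A, P i (w i)]]%SET|%:R <=
    (c%:R / #|T|%:R) ^+ #|A| * #|T|%:R ^+ #|I| :> R.
Proof.
move=> T0 Pc.
have -> : #|[set w : {ffun I -> T} | [forall i in A, P i (w i)]]%SET| =
    (\prod_i #|[set d | (i \in A) ==> P i d]%SET|)%N.
  rewrite -(cardsXn (fun i => [set d | (i \in A) ==> P i d]%SET)).
  apply: eq_card => w; rewrite !inE.
  by apply/forallP/forallP => h i; have := h i; rewrite !inE.
have -> : (c%:R / #|T|%:R) ^+ #|A| * #|T|%:R ^+ #|I| =
    \prod_i (if i \in A then c%:R else #|T|%:R) :> R.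
  rewrite [RHS](bigID (mem A))/= (eq_bigr (fun=> c%:R)); last by move=> i ->.
  rewrite [X in _ = _ * X](eq_bigr (fun=> #|T|%:R)); last by move=> i /negbTE->.
  rewrite !prodr_const -(cardC A) exprD exprMn exprVn.
  by field; rewrite expf_neq0// pnatr_eq0 -lt0n.
rewrite natr_prod; apply: ler_prod => i _; rewrite ler0n/=.
case: ifPn => iA; rewrite ler_nat.
  rewrite (leq_trans _ (Pc i iA))// subset_leq_card//.
  by apply/fintype.subsetP => d; rewrite !inE.
by rewrite cardsE max_card.
Qed.

Lemma card_bigcup_le (X W : finType) (P : pred X) (F : X -> {set W}) (c : R) :
  (forall x, P x -> #|F x|%:R <= c) ->
  #|(\bigcup_(x | P x) F x)%SET|%:R <= #|[set x | P x]%SET|%:R * c.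
Proof.
move=> Fc; apply: (@le_trans _ _ (\sum_(x | P x) #|F x|%:R)).
  rewrite -natr_sum ler_nat; elim/big_ind2: _ => [|Y y Z z Yy Zz|//].
    by rewrite cards0.
  by rewrite (leq_trans (leq_card_setU _ _))// leq_add.
rewrite mulr_natl -sumr_const; apply: (le_trans (ler_sum _ Fc)).
by rewrite le_eqVlt; apply/orP; left; apply/eqP/eq_bigl => x; rewrite inE.
Qed.

(* Markov's inequality for the generating function
   [\sum_S x ^+ #|S| = (1 + x) ^+ n] of the subsets of ['I_n]. *)
Lemma card_small_sets_le (n s : nat) (x : R) : 0 < x <= 1 ->
  #|[set S : {set 'I_n} | (#|S| <= s)%N]%SET|%:R <= (1 + x) ^+ n / x ^+ s.
Proof.
move=> /andP[x0 x1].
rewrite ler_pdivlMr ?exprn_gt0// mulr_natl -sumr_const.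
have -> : (1 + x) ^+ n = \sum_(S : {set 'I_n}) x ^+ #|S|.
  have -> : (1 + x) ^+ n = \prod_(i < n) (x + 1).
    by rewrite prodr_const card_ord addrC.
  rewrite bigA_distr/=.
  apply: eq_big => // S _.
  by rewrite -big_mkcond/= prodr_const.
rewrite [leRHS](bigID (mem [set S : {set 'I_n} | (#|S| <= s)%N]%SET))/=.
rewrite -[leLHS]addr0 lerD//; last first.
  by rewrite sumr_ge0// => S _; rewrite exprn_ge0// ltW.
by apply: ler_sum => S; rewrite inE => Ss; rewrite ler_wiXn2l// ltW.
Qed.
End Counting.

(** * Sumsets with a bounded summand *)

Section SumsetNull.
Variables (R : realType) (b : nat).
Hypothesis hb : (2 <= b)%N.

Let b0 : 0 < b%:R :> R. Proof. by rewrite ltr0n; lia. Qed.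

Definition supp_sumset (G H : pred nat) (M : nat) (a : digit_series b) : Prop :=
  forall n, (M <= n)%N ->
    ((0 < a n)%N <-> exists i j, [/\ G i, H j & (i + j)%N = n]).

Lemma supp_sumsetC G H M a : supp_sumset G H M a -> supp_sumset H G M a.
Proof.
move=> GH n Mn; split=> [/(GH n Mn)[i [j [Gi Hj ij]]]|[i [j [Hi Gj ij]]]].
  by exists j, i; rewrite addnC.
by apply/(GH n Mn); exists j, i; rewrite addnC.
Qed.

Lemma supp_sumsetS G H M N a : (M <= N)%N ->
  supp_sumset G H M a -> supp_sumset G H N a.
Proof. by move=> MN GH n Nn; apply: GH; exact: leq_trans Nn. Qed.

(* In almost every [a] some block of length [2 M + 1] has its middle digit as
   its only nonzero digit. If the middle position is [i + j] with [i] in [G],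
   then [i' + j] is another nonzero digit of that block for [i' != i] in [G]. *)
Lemma null_bounded_summand M :
  null_digits R [set a : digit_series b | exists G H : pred nat,
    [/\ forall i, G i -> (i <= M)%N, exists i j, [/\ G i, G j & i <> j] &
        supp_sumset G H M a]].
Proof.
apply: (null_digits_small hb) => e e0.
pose m := M.*2.+1.
pose T := {ffun 'I_m -> 'I_b}.
pose one : 'I_b := Ordinal hb.
pose zero : 'I_b := Ordinal (ltnW hb).
pose u : T := [ffun r : 'I_m => if r == M :> nat then one else zero].
have cT : #|{: T}| = (b ^ m)%N by rewrite card_ffun !card_ord.
have T0 : (0 < #|{: T}|)%N by rewrite cT expn_gt0; lia.
have [k hk] : exists k, forall n, (k <= n)%N ->
    (#|{: T}|.-1%:R / #|{: T}|%:R) ^+ n < e.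
  apply: exists_expr_lt => //; rewrite divr_ge0//=.
  by rewrite ltr_pdivrMr ?ltr0n// mul1r ltr_nat prednK.
pose enc (a : digit_series b) : {ffun 'I_k.+1 -> T} :=
  [ffun i : 'I_k.+1 => [ffun r : 'I_m => a (i * m + r)%N]].
(* Block 0 is left unconstrained: in a later block the second position [g' + h] is at least [M],
   where the sumset condition applies. *)
exists (m * k.+1)%N, _, enc,
  [set w : {ffun 'I_k.+1 -> T} | [forall i in [set~ ord0], w i != u]]%SET.
split.
- move=> a c ac j jk.
  have jm : (j %% m < m)%N by rewrite ltn_mod.
  have jd : (j %/ m < k.+1)%N by rewrite ltn_divLR// mulnC.
  have := congr1 (fun w : {ffun 'I_k.+1 -> T} => w (Ordinal jd) (Ordinal jm)) ac.
  by rewrite !ffunE/= -divn_eq.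
- move=> a [G [H [GM [i1 [i2 [Gi1 Gi2 i12]]] GH]]].
  rewrite inE; apply/'forall_implyP => i; rewrite !inE => i0.
  apply/eqP => /ffunP iu.
  have mid r : (r < m)%N -> (0 < a (i * m + r))%N = (r == M).
    move=> rm; have := iu (Ordinal rm); rewrite !ffunE/= => ->.
    by case: eqP.
  have im : (m <= i * m)%N by rewrite leq_pmull// lt0n.
  have /GH : (M <= i * m + M)%N by lia.
  rewrite mid ?eqxx; last by rewrite /m; lia.
  move=> [/(_ isT)[g [h [Gg Hh gh]]] _].
  have [g' [Gg' gg']] : exists g', G g' /\ g' <> g.
    by have [e1|e1] := eqVneq i1 g; [exists i2; split => // ?; lia|exists i1; split => //; lia].
  have := GM _ Gg; have := GM _ Gg' => g'M gM.
  have rm : (g' + h - i * m < m)%N by rewrite /m in im *; lia.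
  have : (0 < a (g' + h))%N.
    by apply/GH; [rewrite /m in im; lia|exists g', h].
  have -> : (g' + h)%N = (i * m + (g' + h - i * m))%N by rewrite /m in im *; lia.
  by rewrite mid// => /eqP; rewrite /m in im *; lia.
- apply: le_lt_trans (hk k (leqnn k)).
  rewrite ler_pdivrMr ?exprn_gt0//.
  apply: (le_trans (@card_words_le R _ T _ (fun _ d => d != u) #|{: T}|.-1 T0 _)).
    by move=> i _; rewrite -(cardC1 u); apply: subset_leq_card; apply/fintype.subsetP.
  by rewrite cardsC1 !card_ord cT natrX exprM.
Qed.
End SumsetNull.

(** * Words forced by a dense summand *)

Lemma card_nonzero_digits (b : nat) : (2 <= b)%N ->
  #|[pred d : 'I_b | (0 < d)%N]| = b.-1.
Proof.
move=> hb.
rewrite -[in RHS](card_ord b) -(cardC1 (Ordinal (ltnW hb))).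
by apply: eq_card => d; rewrite !inE lt0n.
Qed.

Section Dense.
Variables (b M J t k : nat).

Local Notation n := (M * J)%N.
Local Notation word := {ffun 'I_(n + M) -> 'I_b}.

Lemma residue_pos_lt (i : 'I_J) (r g : 'I_M) : (i * M + r + g < n + M)%N.
Proof.
have : (i.+1 * M <= J * M)%N by rewrite leq_mul2r ltn_ord orbT.
by have := ltn_ord r; have := ltn_ord g; nia.
Qed.

Definition residue_pos i r g : 'I_(n + M) := Ordinal (residue_pos_lt i r g).

(** The triple [x] holds a set of elements of one summand below [M], a residue [r], and a set of
    quotients [i] for which [i * M + r] lies in the other summand. *)
Definition residue_sumset (x : {set 'I_M} * 'I_M * {set 'I_J}) : {set 'I_(n + M)} :=
  [set residue_pos y.1 x.1.2 y.2 | y in finset.setX x.2 x.1.1]%SET.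

(** After cancelling [r], division by [M] recovers [i] and [g] from [i * M + g], because [g < M]. *)
Lemma card_residue_sumset x : #|residue_sumset x| = (#|x.2| * #|x.1.1|)%N.
Proof.
rewrite card_imset ?cardsX// => -[i g] [i' g'] /(congr1 val)/= ig.
have M0 : (0 < M)%N by have := ltn_ord g; lia.
have e : (i * M + g = i' * M + g')%N by lia.
have /val_inj ii : i = i' :> nat.
  by have := congr1 (divn^~ M) e; rewrite !divnMDl// !divn_small// !addn0.
have /val_inj gg : g = g' :> nat.
  by have := congr1 (modn^~ M) e; rewrite /= !modnMDl !modn_small.
by rewrite ii gg.
Qed.

(* A set with more than [M * t] elements below [M * J] has [t] elements in one
   residue class mod [M]. Sums of elements of one class with elements of
   ['I_M] are pairwise distinct, so a word in which all of them are nonzero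
   satisfies independent conditions. *)
Definition dense_words : {set word} :=
  (\bigcup_(x : {set 'I_M} * 'I_M * {set 'I_J} | (k <= #|x.1.1|)%N && (t <= #|x.2|)%N)
    [set w : word | [forall q in residue_sumset x, (0 < w q)%N]])%SET.

Lemma dense_words_mem (G H : pred nat) (a : digit_series b) :
  supp_sumset G H M a ->
  (k <= #|[set i : 'I_M | G i]%SET|)%N ->
  (M * t < #|[set i : 'I_n | H i]%SET|)%N ->
  [ffun q : 'I_(n + M) => a q] \in dense_words.
Proof.
move=> GH kG tH.
have [r tr] : exists r : 'I_M, (t < #|[set i : 'I_J | H (i * M + r)%N]%SET|)%N.
  apply/existsP; apply: contraTT tH; rewrite negb_exists -leqNgt => /forallP h.
  have -> : #|[set i : 'I_n | H i]%SET| =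
      (\sum_(r < M) #|[set i : 'I_J | H (i * M + r)%N]%SET|)%N.
    rewrite -sum1_card big_mkcond/= (eq_bigr (fun i : 'I_n => H i : nat)); last first.
      by move=> i _; rewrite inE.
    rewrite -(big_mkord xpredT (fun i => H i : nat)) (mulnC M) big_nat_mul/= big_mkord.
    transitivity (\sum_(i < J) \sum_(r < M) (H (i * M + r)%N : nat))%N.
      apply: eq_bigr => i _; rewrite -{1}[(i * M)%N]add0n big_addn mulSn addnK big_mkord.
      by apply: eq_bigr => r _; rewrite addnC.
    rewrite exchange_big/=; apply: eq_bigr => r _.
    by rewrite -sum1_card [RHS]big_mkcond/=; apply: eq_bigr => i _; rewrite inE.
  apply: (@leq_trans (\sum_(r < M) t)%N); last by rewrite sum_nat_const card_ord.
  by apply: leq_sum => r _; rewrite leqNgt.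
apply/finset.bigcupP.
(* Quotient 0 is dropped to keep all sums at or above [M]; the strict bound [tr] still leaves [t]
   quotients. *)
exists ([set i : 'I_M | G i]%SET, r,
  [set i : 'I_J | H (i * M + r)%N && (0 < i)%N]%SET).
  have J0 : (0 < J)%N by move: (leq_ltn_trans (leq0n t) tr) => /card_gt0P[[i]]; lia.
  move: tr; rewrite (cardsD1 (Ordinal J0)) => tr; rewrite kG/=.
  have tr' := leq_trans tr (leq_add (leq_b1 _) (leqnn _)).
  rewrite -ltnS (leq_trans tr')//= add1n ltnS subset_leq_card//; apply/fintype.subsetP => i.
  by rewrite !inE -val_eqE/= lt0n andbC.
rewrite inE; apply/'forall_implyP => q /imsetP[[i g]].
rewrite !inE/= => /andP[/andP[Hi i0] Gg] ->; rewrite ffunE/=.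
apply/GH; last by exists g, (i * M + r)%N; rewrite Gg Hi addnC.
by have : (M <= i * M)%N by [rewrite leq_pmull]; lia.
Qed.

Variable R : realType.
Hypothesis hb : (2 <= b)%N.
Local Notation p := (b.-1%:R / b%:R : R).

Let b0 : 0 < b%:R :> R. Proof. by rewrite ltr0n; lia. Qed.

Let p01 : 0 <= p <= 1.
Proof. by rewrite divr_ge0//= ler_pdivrMr// mul1r ler_nat leq_pred. Qed.

(** There are at most $2^M M 2^J$ triples, and each forces at least [t * k] digits to be nonzero, at
    a factor [p] per digit. *)
Lemma card_dense_words :
  #|dense_words|%:R <= (2 ^ M * M * 2 ^ J)%:R * (p ^+ (t * k) * b%:R ^+ (n + M)).
Proof.
have pb : 0 <= p ^+ (t * k) * b%:R ^+ (n + M).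
  by rewrite mulr_ge0 ?exprn_ge0// ltW.
rewrite /dense_words.
apply: le_trans (card_bigcup_le (c := p ^+ (t * k) * b%:R ^+ (n + M)) _) _.
  move=> x /andP[kx tx].
  apply: (le_trans (@card_words_le R _ 'I_b _ (fun _ d => (0 < d)%N) b.-1 _ _)).
  - by rewrite card_ord; lia.
  - by move=> q _; rewrite -(card_nonzero_digits hb).
  rewrite !card_ord card_residue_sumset ler_pM2r ?exprn_gt0//.
  by case/andP: p01 => p0 p1; apply: ler_wiXn2l => //; exact: leq_mul.
apply: ler_wpM2r => //; rewrite ler_nat (leq_trans (max_card _))//.
by rewrite !card_prod -!cardsT -!powersetT !card_powerset !cardsT !card_ord.
Qed.

End Dense.

(** * Words determined by two sparse summands *)

Section Sparse.
Variables (b M n s : nat).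
Local Notation word := {ffun 'I_(n + M) -> 'I_b}.

(** Below [M] the sumset condition says nothing, and from [n] on the parts of the summands below [n]
    no longer decide it. The length [n + M] matches that of the dense words. *)
Definition sparse_words : {set word} :=
  (\bigcup_(x : {set 'I_n} * {set 'I_n} | (#|x.1| <= s)%N && (#|x.2| <= s)%N)
    [set w : word | [forall q in [set q : 'I_(n + M) | (M <= q < n)%N],
      (0 < w q)%N == [exists g in x.1, exists h in x.2, (g + h)%N == q]]])%SET.

Lemma sparse_words_mem (G H : pred nat) (a : digit_series b) :
  supp_sumset G H M a ->
  (#|[set i : 'I_n | G i]%SET| <= s)%N -> (#|[set i : 'I_n | H i]%SET| <= s)%N ->
  [ffun q : 'I_(n + M) => a q] \in sparse_words.
Proof.
move=> GH Gs Hs; apply/finset.bigcupP.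
exists ([set i : 'I_n | G i]%SET, [set i : 'I_n | H i]%SET); first by rewrite Gs.
rewrite inE; apply/'forall_implyP => q; rewrite !inE ffunE => /andP[Mq qn].
apply/eqP; apply/idP/idP => [/(GH _ Mq)[g [h [Gg Hh gh]]]|].
  have gn : (g < n)%N by lia.
  have hn : (h < n)%N by lia.
  apply/'exists_andP; exists (Ordinal gn); rewrite inE; split => //.
  by apply/'exists_andP; exists (Ordinal hn); rewrite inE; split => //; exact/eqP.
move=> /'exists_andP[g [Gg /'exists_andP[h [Hh /eqP gh]]]].
by rewrite !inE in Gg Hh; apply/GH => //; exists g, h.
Qed.

Variable R : realType.
Hypothesis hb : (2 <= b)%N.
Local Notation p := (b.-1%:R / b%:R : R).

Hypothesis Mn : (M <= n)%N.

Let b0 : 0 < b%:R :> R. Proof. by rewrite ltr0n; lia. Qed.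

(** A fixed pair of sets prescribes at each of [n - M] positions whether the digit is zero. This
    leaves 1 or [b.-1] digits, at most [b.-1] in both cases. *)
Lemma card_sparse_words (x : R) : 0 < x <= 1 ->
  #|sparse_words|%:R <=
    ((1 + x) ^+ n / x ^+ s) ^+ 2 * (p ^+ (n - M) * b%:R ^+ (n + M)).
Proof.
move=> x01.
have pb : 0 <= p ^+ (n - M) * b%:R ^+ (n + M).
  by rewrite mulr_ge0 ?exprn_ge0 ?divr_ge0// ltW.
rewrite /sparse_words.
apply: le_trans (card_bigcup_le (c := p ^+ (n - M) * b%:R ^+ (n + M)) _) _.
  move=> [S1 S2] _ /=.
  apply: (le_trans (@card_words_le R 'I_(n + M) 'I_b _ (fun q d => (0 < d)%N ==
    [exists g in S1, exists h in S2, (g + h)%N == q]) b.-1 _ _)).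
  - by rewrite card_ord; lia.
  - move=> q _; case: [exists g in S1, _].
      rewrite -(card_nonzero_digits hb); apply/eq_leq/eq_card => d.
      by rewrite unfold_in inE; case: (0 < d)%N.
    rewrite (@leq_trans #|pred1 (Ordinal (ltnW hb))|)//; last by rewrite card1; lia.
    apply/eq_leq/eq_card => d.
    by rewrite unfold_in inE -val_eqE/= lt0n; case: (d == 0 :> nat)%N.
  suff -> : #|[set q : 'I_(n + M) | (M <= q < n)%N]%SET| = (n - M)%N by rewrite !card_ord.
  rewrite -sum1_card big_mkcond/=.
  rewrite (eq_bigr (fun q : 'I_(n + M) => if (M <= q < n)%N then 1%N else 0%N)); last first.
    by move=> q _; rewrite inE.
  rewrite -(big_mkord xpredT (fun q => if (M <= q < n)%N then 1%N else 0%N)) -big_mkcond/=.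
  rewrite -(big_nat_widen 0 n (n + M) (fun q => M <= q)%N) ?leq_addr//.
  by rewrite -(big_nat_widenl M 0 n xpredT)// sum_nat_const_nat muln1.
apply: ler_wpM2r => //.
rewrite (_ : [set x | _]%SET = finset.setX [set S : {set 'I_n} | (#|S| <= s)%N]%SET
  [set S : {set 'I_n} | (#|S| <= s)%N]%SET); last first.
  by apply/setP => -[S1 S2]; rewrite !inE.
by rewrite cardsX natrM expr2 ler_pM// card_small_sets_le.
Qed.

End Sparse.

(** * Sumsets with two unbounded summands *)

Section UnboundedSummands.
Variables (R : realType) (b : nat).
Hypothesis hb : (2 <= b)%N.
Local Notation p := (b.-1%:R / b%:R : R).

Let b0 : 0 < b%:R :> R. Proof. by rewrite ltr0n; lia. Qed.

Let p0 : 0 < p.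
Proof. by rewrite divr_gt0// ltr0n; lia. Qed.

Let p1 : p < 1.
Proof. by rewrite ltr_pdivrMr// mul1r ltr_nat; lia. Qed.

(** With [n = M * L * t] and threshold [M * t], sparse means density at most $1/L$. Both terms are
    constants times [t]-th powers, ready for [t] to grow. *)
Lemma union_bound_ratio (M L t k : nat) (x : R) : (0 < M)%N -> (0 < L)%N ->
   (0 < t)%N -> 0 < x <= 1 ->
   #|(@dense_words b M (L * t) t k :|: @sparse_words b M (M * (L * t)) (M * t))%SET|%:R
     / b%:R ^+ (M * (L * t) + M) <=
   (2 ^ M * M)%:R * (2 ^+ L * p ^+ k) ^+ t +
     (p ^+ M)^-1 * (((p * (1 + x) ^+ 2) ^+ L / x ^+ 2) ^+ M) ^+ t.
Proof.
move=> M0 L0 t0 x01; have /andP[x0 _] := x01.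
set n := (M * (L * t))%N.
have Mn : (M <= n)%N by rewrite leq_pmulr// muln_gt0 L0.
rewrite ler_pdivrMr ?exprn_gt0//.
apply: (@le_trans _ _ (#|@dense_words b M (L * t) t k|%:R +
    #|@sparse_words b M n (M * t)|%:R)).
  by rewrite -natrD ler_nat leq_card_setU.
have h1 := card_dense_words M (L * t) t k R hb.
have h2 := card_sparse_words (M * t) hb Mn x01.
apply: (le_trans (lerD h1 h2)).
rewrite mulrDl lerD// le_eqVlt; apply/orP; left; apply/eqP.
  rewrite natrM mulrA; congr (_ * _); rewrite -mulrA; congr (_ * _).
  by rewrite [RHS]exprMn -!exprM natrX (mulnC k).
rewrite mulrA; congr (_ * _).
move: (p) p0 => q q0.
have -> : q ^+ (n - M) = q ^+ n / q ^+ M.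
  by rewrite -{2}(subnK Mn) exprD mulfK// expf_neq0// gt_eqF.
rewrite !exprMn !exprVn -!exprM.
rewrite (_ : L * (M * t) = n)%N; last by rewrite /n; lia.
rewrite (_ : 2 * (M * t) = M * t * 2)%N; last by lia.
by rewrite -exprD addnn -muln2; ring.
Qed.

(** Here [k] precedes [M], since the theorem picks [M] large enough for both summands to have [k]
    elements below it. The choices run [x], [L], [k], and [t] last. *)
Lemma null_unbounded_summands : exists k, forall M, (0 < M)%N ->
  null_digits R [set a : digit_series b | exists G H : pred nat,
    [/\ supp_sumset G H M a, (k <= #|[set i : 'I_M | G i]%SET|)%N &
        (k <= #|[set i : 'I_M | H i]%SET|)%N]].
Proof.
(* As $p = 1 - 4x$, one gets $p(1+x)^2 = 1 - 2x - 7x^2 - 4x^3 < 1$. *)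
pose x : R := (1 - p) / 4.
have x01 : 0 < x <= 1.
  by rewrite /x; move: (p) p0 p1 => q q0 q1; apply/andP; split; lra.
have /andP[x0 _] := x01.
have c01 : 0 <= p * (1 + x) ^+ 2 < 1.
  rewrite mulr_ge0 ?sqr_ge0 ?(ltW p0)//=.
  by rewrite /x expr2; move: (p) p0 p1 => q q0 q1; nra.
(* [L] brings the base of the sparse term below 1; then [k] does so for the dense term by beating
   $2^L$. *)
have [L0 hL0] := exists_expr_lt c01 (exprn_gt0 2 x0).
pose L := L0.+1.
have hL := hL0 L (leqnSn _).
have p01 : 0 <= p < 1 by rewrite (ltW p0).
have [k hk0] := exists_expr_lt p01 (ltac:(by rewrite invr_gt0 exprn_gt0) : 0 < (2 ^+ L)^-1 :> R).
have hk := hk0 k (leqnn _).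
exists k => M M0; apply: (null_digits_small hb) => e e0.
have q1 : 0 <= 2 ^+ L * p ^+ k < 1.
  rewrite mulr_ge0 ?exprn_ge0// ?(ltW p0)//=.
  by rewrite mulrC -ltr_pdivlMr ?exprn_gt0// div1r.
have q2 : 0 <= ((p * (1 + x) ^+ 2) ^+ L / x ^+ 2) ^+ M < 1.
  have h : 0 <= (p * (1 + x) ^+ 2) ^+ L / x ^+ 2.
    by rewrite divr_ge0 ?exprn_ge0 ?(ltW x0)//; case/andP: c01.
  by rewrite exprn_ge0//= exprn_ilt1 -?lt0n// ltr_pdivrMr ?exprn_gt0// mul1r.
have e1 : 0 < e / 2 / (2 ^ M * M)%:R.
  by rewrite !divr_gt0// ltr0n muln_gt0 expn_gt0.
have e2 : 0 < e / 2 * p ^+ M by rewrite mulr_gt0 ?divr_gt0// exprn_gt0.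
have [t1 ht1] := exists_expr_lt q1 e1.
have [t2 ht2] := exists_expr_lt q2 e2.
pose t := (maxn t1 t2).+1.
pose n := (M * (L * t))%N.
exists (n + M)%N, _, (fun a : digit_series b => [ffun q : 'I_(n + M) => a q]),
  (dense_words b M (L * t) t k :|: sparse_words b M n (M * t))%SET; split.
- move=> a c ac j jn.
  have := congr1 (fun w : {ffun 'I_(n + M) -> 'I_b} => w (Ordinal jn)) ac.
  by rewrite !ffunE.
- move=> a [G [H [GH kG kH]]]; rewrite finset.in_setU.
  (* If either summand is dense, the other one supplies the [k] small elements; otherwise both are
     sparse. *)
  have [Gn|Gn] := leqP #|[set i : 'I_n | G i]%SET| (M * t); last first.
    by rewrite (dense_words_mem (supp_sumsetC GH)).
  have [Hn|Hn] := leqP #|[set i : 'I_n | H i]%SET| (M * t); last first.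
    by rewrite (dense_words_mem GH).
  by rewrite (sparse_words_mem GH Gn Hn) orbT.
- apply: (le_lt_trans (union_bound_ratio k M0 (ltn0Sn L0) (ltn0Sn _) x01)).
  have /ht1 : (t1 <= t)%N := leqW (leq_maxl _ _).
  have /ht2 : (t2 <= t)%N := leqW (leq_maxr _ _).
  rewrite ltr_pdivlMr ?ltr0n ?muln_gt0 ?expn_gt0// (mulrC _ (2 ^ M * M)%:R) => b2 b1.
  by rewrite [ltRHS]splitr ltrD// mulrC ltr_pdivrMr ?exprn_gt0//.
Qed.
End UnboundedSummands.

(** * From series to supports, and conclusion *)

Definition mm_nonzero (c : maxmin) : bool := if c is Fin 0 then false else true.

(** Being nonzero turns max into disjunction and min into conjunction, so convolution becomes the
    sumset of supports. *)
Lemma mm_nonzero_mul (g h : mm_series) n :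
  mm_nonzero (mm_series_mul g h n) <->
  exists i j, [/\ mm_nonzero (g i), mm_nonzero (h j) & (i + j)%N = n].
Proof.
have finE m : mm_nonzero (Fin m) = (0 < m)%N by case: m.
have addE c d : mm_nonzero (mm_add c d) = mm_nonzero c || mm_nonzero d.
  by case: c d => [c|] [d|]; rewrite [mm_add _ _]/= ?orbT// !finE leq_max.
have mulE c d : mm_nonzero (mm_mul c d) = mm_nonzero c && mm_nonzero d.
  by case: c d => [c|] [d|]; rewrite [mm_mul _ _]/= ?andbT// !finE leq_min.
rewrite /mm_series_mul (big_morph _ addE (erefl : mm_nonzero mm_zero = false)).
rewrite big_orE; split.
  move=> /existsP[i]; rewrite mulE => /and3P[_ gi hi].
  by exists i, (n - i)%N; split => //; rewrite subnKC// -ltnS.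
move=> [i [j [gi hj <-]]]; apply/existsP.
by exists (Ordinal (leq_addr j i : (i < (i + j).+1)%N)); rewrite mulE gi/= addKn.
Qed.

Lemma nonzero_pair (g : mm_series) : ~ is_monomial g ->
  exists i j, [/\ mm_nonzero (g i), mm_nonzero (g j) & i <> j].
Proof.
have nz c : ~~ mm_nonzero c -> c = mm_zero by case: c => [[]|].
move=> ng; apply: contrapT => np; apply: ng.
have [[i gi]|g0] := pselect (exists i, mm_nonzero (g i)); last first.
  exists mm_zero, 0%N => n; rewrite if_same; apply: nz; apply/negP => gn.
  by apply: g0; exists n.
exists (g i), i => n; case: eqP => [->//|ni].
by apply: nz; apply/negP => gn; apply: np; exists i, n; split => // /esym.
Qed.

Lemma unbounded_card_ge (G : pred nat) k : (forall D, exists2 i, (D <= i)%N & G i) ->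
  exists M, forall N, (M <= N)%N -> (k <= #|[set i : 'I_N | G i]%SET|)%N.
Proof.
move=> hG; have cardE N : #|[set i : 'I_N | G i]%SET| = (\sum_(0 <= i < N) G i)%N.
  rewrite big_mkord -sum1_card big_mkcond/=.
  by apply: eq_bigr => i _; rewrite inE; case: (G i).
elim: k => [|k [M hM]]; first by exists 0%N.
have [i Mi Gi] := hG M; exists i.+1 => N iN.
rewrite cardE (@big_cat_nat _ _ _ i.+1)//= big_nat_recr//= Gi -cardE.
by have := hM _ Mi; lia.
Qed.

Lemma reducible_supp b (a : digit_series b) :
  ~ asymp_irreducible (series_of_digits a) ->
  exists N (G H : pred nat), [/\ supp_sumset G H N a,
    exists i j, [/\ G i, G j & i <> j] & exists i j, [/\ H i, H j & i <> j]].
Proof.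
move=> /existsNP[g /existsNP[h /not_implyP[eqv /not_orP[ng nh]]]].
have [N hN] : exists N, forall n, (N <= n)%N ->
    series_of_digits a n = mm_series_mul g h n.
  move/finite_seqP: eqv => [s es]; exists (\max_(i <- s) i).+1 => n sn.
  apply: contrapT => ne; have : [set` s] n by rewrite -es.
  by move=> /= /(leq_bigmax_seq (F := id)) /(_ isT); rewrite leqNgt sn.
exists N, (fun i => mm_nonzero (g i)), (fun i => mm_nonzero (h i)).
split; [|exact: nonzero_pair..] => n Nn.
rewrite -mm_nonzero_mul -hN// /series_of_digits.
by case: (a n) => -[].
Qed.

Theorem theorem1p9 (R : realType) (b : nat) (hb : (2 <= b)%N) :
  let A := [set a : digit_series b |
              ~ asymp_irreducible (series_of_digits a)] in
  m_measurable R A /\ m_measure R A = 0%E.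
Proof.
move=> A; apply: null_digits_measure0.
have [k nullU] := null_unbounded_summands R hb.
have nullB := null_bounded_summand R hb.
(* The shift to [M.+1] meets the positivity condition in [nullU] while the countable union runs over
   all [M]. *)
have null2 := null_digits_bigcup (fun M => null_digitsU (nullB M) (nullU M.+1 (ltn0Sn M))).
apply: null_digitsS null2 => a /reducible_supp[N [G [H [GH G2 H2]]]].
have bdd (G' : pred nat) : (exists D, forall i, G' i -> (i <= D)%N) \/
    (forall D, exists2 i, (D <= i)%N & G' i).
  have [?|nb] := pselect (exists D, forall i, G' i -> (i <= D)%N); [by left|right].
  move=> D; apply: contrapT => nD; apply: nb; exists D => i Gi.
  by rewrite leqNgt; apply/negP => /ltnW Di; apply: nD; exists i.
have [[D GD]|Gu] := bdd G.
  exists (maxn N D) => //; left; exists G, H; split => //.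
    by move=> i /GD; lia.
  by apply: supp_sumsetS GH; lia.
have [[D HD]|Hu] := bdd H.
  exists (maxn N D) => //; left; exists H, G; split => //.
    by move=> i /HD; lia.
  by apply: supp_sumsetC; apply: supp_sumsetS GH; lia.
have [M1 hM1] := unbounded_card_ge k Gu.
have [M2 hM2] := unbounded_card_ge k Hu.
(* One threshold must serve for the sumset condition and for [k] elements in each summand. *)
exists (maxn N (maxn M1 M2)) => //; right; exists G, H; split.
- by apply: supp_sumsetS GH; lia.
- by apply: hM1; lia.
- by apply: hM2; lia.
Qed.
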